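(* Let $\Gamma\in\{\mathbf{\Pi}^0_2,\mathbf{\Sigma}^0_\alpha,\mathbf{\Pi}^0_\alpha,\mathbf{\Sigma}^1_n,\mathbf{\Pi}^1_n\mid 3\le\alpha<\omega_1,\ 1\le n<\omega\}$, let $X,Y$ be $\Gamma$-spaces, let $A\subseteq X$, $B\subseteq Y$, and let $f$ be a homeomorphism of $A$ onto $B$ (with subspace topologies). Then there exist $A^\ast\in\Gamma(X)$, $B^\ast\in\Gamma(Y)$ and a homeomorphism $f^\ast$ of $A^\ast$ onto $B^\ast$ such that $A\subseteq A^\ast$, $B\subseteq B^\ast$ and $f^\ast|_A=f$.
   Context: Let $\mathcal{N}=\omega^\omega$ be the Baire space. For an arbitrary topological space $X$: $\mathbf{\Sigma}^0_0(X)=\{\emptyset\}$; $\mathbf{\Sigma}^0_1(X)$ = open sets; $\mathbf{\Sigma}^0_2(X)$ = countable unions of sets $U\setminus V$ with $U,V$ open; for $2<\alpha<\omega_1$, $\mathbf{\Sigma}^0_\alpha(X)$ = countable unions of sets whose complements lie in $\bigcup_{\beta<\alpha}\mathbf{\Sigma}^0_\beta(X)$; $\mathbf{\Pi}^0_\alpha(X)$ = complements. $\mathbf{\Sigma}^1_1(X)=\{pr_X(A)\mid A\in\mathbf{\Pi}^0_2(\mathcal{N}\times X)\}$, $\mathbf{\Sigma}^1_{n+1}(X)=\{pr_X(A)\mid A\in\mathbf{\Pi}^1_n(\mathcal{N}\times X)\}$ with $pr_X(A)=\{x\mid\exists p\in\mathcal{N}\,(p,x)\in A\}$; $\mathbf{\Pi}^1_n(X)$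 = complements. $P\omega$ is the power set of $\omega$ with the Scott topology (basic open sets $\{A\subseteq\omega\mid F\subseteq A\}$, $F$ finite). A $\Gamma$-space is a space homeomorphic to a subspace $A\subseteq P\omega$ with $A\in\Gamma(P\omega)$. *)

(* Defs.v *)
From HB Require Import structures.
From mathcomp Require Import all_boot all_order.
From mathcomp Require Import mathcomp_extra boolp classical_sets functions.
From mathcomp Require Import cardinality wochoice.
From mathcomp Require Import topology.

Set Implicit Arguments.
Unset Strict Implicit.
Unset Printing Implicit Defensive.

Local Open Scope classical_set_scope.
Local Open Scope card_scope.

(* A countable ordinal is presented by a point [co_pt] of a countable
   well-order: it is the order type of the set of points strictly below [co_pt].
   Every countable ordinal [a] arises in this way, from the top of [a + 1]. *)
Record countable_ordinal := CountableOrdinal {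
  co_disp : Order.disp_t;
  co_sort : orderType co_disp;
  co_wo : well_order (<=%O : rel co_sort);
  co_countable : countable [set: co_sort];
  co_pt : co_sort
}.

Definition below {d : Order.disp_t} {O : orderType d} (a : O) : set O :=
  [set b | (b < a)%O].

Definition ordinal_ge3 (a : countable_ordinal) : Prop :=
  `I_3 #<= below (co_pt a).

Definition Sigma02 (X : topologicalType) : set (set X) :=
  [set A | exists U V : nat -> set X,
    [/\ forall n, open (U n), forall n, open (V n) &
        A = \bigcup_n (U n `\` V n)]].

Definition Pi02 (X : topologicalType) : set (set X) :=
  [set A | Sigma02 (~` A)].

(* [Sigma0_at a] is the Borel class whose index is the order type of
   [below a]. *)
Inductive Sigma0_at (X : topologicalType) (d : Order.disp_t) (O : orderType d) :
    O -> set X -> Prop :=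
| Sigma0_at0 (a : O) :
    below a #= `I_0 -> Sigma0_at a set0
| Sigma0_at1 (a : O) (U : set X) :
    below a #= `I_1 -> open U -> Sigma0_at a U
| Sigma0_at2 (a : O) (A : set X) :
    below a #= `I_2 -> Sigma02 A -> Sigma0_at a A
| Sigma0_at_gt2 (a : O) (A : nat -> set X) (b : nat -> O) :
    `I_3 #<= below a ->
    (forall n, (b n < a)%O) ->
    (forall n, Sigma0_at (b n) (~` A n)) ->
    Sigma0_at a (\bigcup_n A n).

Definition Sigma0 (a : countable_ordinal) (X : topologicalType) :
    set (set X) :=
  [set A | Sigma0_at (co_pt a) A].

Definition Pi0 (a : countable_ordinal) (X : topologicalType) : set (set X) :=
  [set A | Sigma0 a (~` A)].

Definition baire : topologicalType := prod_topology (fun _ : nat => nat).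

Definition pr_ (X : topologicalType) (A : set (baire * X)%type) : set X :=
  [set x | exists p : baire, A (p, x)].

(* The hierarchy starts at index 1; the value at index 0 is never used. *)
Fixpoint Sigma1 (n : nat) (X : topologicalType) {struct n} : set (set X) :=
  match n with
  | 0 => set0
  | 1 => [set B | exists2 A : set (baire * X)%type, Pi02 A & B = pr_ A]
  | m.+1 => [set B | exists2 A : set (baire * X)%type,
                       Sigma1 m (~` A) & B = pr_ A]
  end.

Definition Pi1 (n : nat) (X : topologicalType) : set (set X) :=
  [set A | Sigma1 n (~` A)].

Inductive pointclass : Type :=
| PC_Pi02
| PC_Sigma0 (a : countable_ordinal) of ordinal_ge3 a
| PC_Pi0 (a : countable_ordinal) of ordinal_ge3 a
| PC_Sigma1 (n : nat) of 0 < n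
| PC_Pi1 (n : nat) of 0 < n.

Definition members (G : pointclass) (X : topologicalType) : set (set X) :=
  match G with
  | PC_Pi02 => @Pi02 X
  | PC_Sigma0 a _ => @Sigma0 a X
  | PC_Pi0 a _ => @Pi0 a X
  | PC_Sigma1 n _ => @Sigma1 n X
  | PC_Pi1 n _ => @Pi1 n X
  end.

(* A copy of [set nat], to carry the Scott topology rather than the pointwise
   one. *)
Definition Pomega : Type := set nat.

HB.instance Definition _ := Choice.on Pomega.

Definition Pomega_base (F : set nat) : set Pomega :=
  [set A : Pomega | F `<=` (A : set nat)].

Lemma Pomega_base_cover :
  \bigcup_(F in @finite_set nat) Pomega_base F = setT.
Proof.
by apply/seteqP; split=> // A _; exists set0; [exact: finite_set0|exact: sub0set].
Qed.

Lemma Pomega_base_join (F G : set nat) (A : Pomega) :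
  finite_set F -> finite_set G -> Pomega_base F A -> Pomega_base G A ->
  exists H, [/\ finite_set H, Pomega_base H A &
    Pomega_base H `<=` Pomega_base F `&` Pomega_base G].
Proof.
move=> finF finG FA GA; exists (F `|` G); split.
- by rewrite finite_setU.
- by rewrite /Pomega_base/= subUset.
- by move=> B; rewrite /Pomega_base/= subUset.
Qed.

HB.instance Definition _ :=
  isBaseTopological.Build Pomega Pomega_base_cover Pomega_base_join.

(* A subset [A : set X], used as a type, carries the subspace topology (the
   initial topology for the inclusion into [X]). *)

Definition homeomorphism (X Y : topologicalType) (f : X -> Y) : Prop :=
  continuous f /\
  exists g : Y -> X, [/\ continuous g, cancel f g & cancel g f].

Definition Gamma_space (G : pointclass) (X : topologicalType) : Prop :=
  exists A : set Pomega,
    members G A /\ exists f : X -> A, homeomorphism f.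

(* Main.v *)
(** Lavrentiev's argument.  Embed [X] and [Y] in [Pomega] by [i] and [j].  Since
   [Pomega] is injective for embeddings, [f] and its inverse extend to
   continuous maps [F] and [G] of [Pomega] into itself.  The points [x] of [X]
   with [F (i x)] in the range of [j] and [G (F (i x)) = i x] form a set on
   which [F] induces a homeomorphism onto the symmetrically defined subset of
   [Y].  The second condition is [Pi02], because equality in [Pomega] is, so it
   remains to see that every class in question is closed under continuous
   preimages and under intersection with [Pi02] sets. *)

Require Import Defs.
From mathcomp Require Import all_boot all_order.
From mathcomp Require Import boolp classical_sets functions topology.
From mathcomp Require Import cardinality wochoice.

Set Implicit Arguments.
Unset Strict Implicit.
Unset Printing Implicit Defensive.

Import Order.TTheory.

Local Open Scope classical_set_scope.
Local Open Scope card_scope.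

(** * The classes [Sigma02] and [Pi02] in an arbitrary space *)

(** Allowing any countable index type lets later unions run over sums, products and booleans;
    numbers that code no index contribute the empty difference. *)
Lemma Sigma02_intro (X : topologicalType) (I : countType)
    (U V : I -> set X) (A : set X) :
  (forall i, open (U i)) -> (forall i, open (V i)) ->
  (forall x, A x <-> exists i, U i x /\ ~ V i x) -> Sigma02 A.
Proof.
move=> oU oV AE.
exists (fun n => if unpickle n is Some i then U i else set0).
exists (fun n => if unpickle n is Some i then V i else set0).
split=> [n|n|]; try by case: (unpickle n) => [i|]//; exact: open0.
apply/seteqP; split=> x.
  by move=> /AE[i [Ui Vi]]; exists (pickle i) => //=; rewrite pickleK.
case=> n _ /=; case: (unpickle n) => [i|] [Ui Vi] //.
by apply/AE; exists i.
Qed.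

Lemma Sigma02P (X : topologicalType) (A : set X) : Sigma02 A ->
  exists U V : nat -> set X, [/\ forall n, open (U n), forall n, open (V n) &
    forall x, A x <-> exists n, U n x /\ ~ V n x].
Proof.
case=> U [V [oU oV ->]]; exists U, V; split=> // x.
by split=> [[n _ ?]|[n ?]]; exists n.
Qed.

Lemma open_Sigma02 (X : topologicalType) (U : set X) : open U -> Sigma02 U.
Proof.
move=> oU; apply: (@Sigma02_intro _ unit (fun=> U) (fun=> set0)) => //.
  by move=> _; exact: open0.
by move=> x; split=> [Ux|[_ []]]//; exists tt; split.
Qed.

(** The complement is the union of [setT] minus [U] and [V] minus [set0], which are again
    differences of open sets. *)
Lemma setC_diff_Sigma02 (X : topologicalType) (U V : set X) :
  open U -> open V -> Sigma02 (~` (U `\` V)).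
Proof.
move=> oU oV.
apply: (@Sigma02_intro _ bool (fun b => if b then setT else V)
                              (fun b => if b then U else set0)).
- by case=> //; exact: openT.
- by case=> //; exact: open0.
move=> x; split=> [/not_andP[nUx|/contrapT Vx]|[[] /= [_ H]] []//].
- by exists true.
- by exists false; split.
Qed.

Lemma Sigma02_setU (X : topologicalType) (A B : set X) :
  Sigma02 A -> Sigma02 B -> Sigma02 (A `|` B).
Proof.
move=> /Sigma02P[U [V [oU oV AE]]] /Sigma02P[U' [V' [oU' oV' BE]]].
apply: (@Sigma02_intro _ (nat + nat)%type
  (fun s => match s with inl n => U n | inr n => U' n end)
  (fun s => match s with inl n => V n | inr n => V' n end)).
- by case.
- by case.
move=> x; split=> [[/AE[n ?]|/BE[n ?]]|[[n|n] ?]].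
- by exists (inl n).
- by exists (inr n).
- by left; apply/AE; exists n.
- by right; apply/BE; exists n.
Qed.

Lemma Sigma02_setI (X : topologicalType) (A B : set X) :
  Sigma02 A -> Sigma02 B -> Sigma02 (A `&` B).
Proof.
move=> /Sigma02P[U [V [oU oV AE]]] /Sigma02P[U' [V' [oU' oV' BE]]].
apply: (@Sigma02_intro _ (nat * nat)%type
  (fun s => U s.1 `&` U' s.2) (fun s => V s.1 `|` V' s.2)).
- by move=> s; exact: openI.
- by move=> s; exact: openU.
move=> x; split=> [[/AE[n [? ?]] /BE[m [? ?]]]|[[n m]]].
  by exists (n, m); split=> // -[].
move=> /= [[? ?] /not_orP[? ?]]; split; first by apply/AE; exists n.
by apply/BE; exists m.
Qed.

Lemma Sigma02_preimage (X Y : topologicalType) (f : X -> Y) (A : set Y) :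
  continuous f -> Sigma02 A -> Sigma02 (f @^-1` A).
Proof.
move=> /continuousP cf [U [V [oU oV ->]]].
exists (fun n => f @^-1` U n), (fun n => f @^-1` V n).
split=> [n|n|]; [exact: cf|exact: cf|].
by rewrite preimage_bigcup.
Qed.

Lemma Pi02_setI (X : topologicalType) (A B : set X) :
  Pi02 A -> Pi02 B -> Pi02 (A `&` B).
Proof. by rewrite /Pi02/= setCI; exact: Sigma02_setU. Qed.

Lemma Pi02_setU (X : topologicalType) (A B : set X) :
  Pi02 A -> Pi02 B -> Pi02 (A `|` B).
Proof. by rewrite /Pi02/= setCU; exact: Sigma02_setI. Qed.

Lemma Pi02_preimage (X Y : topologicalType) (f : X -> Y) (A : set Y) :
  continuous f -> Pi02 A -> Pi02 (f @^-1` A).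
Proof. exact: Sigma02_preimage. Qed.

(** * Borel classes of index at least 3 *)

Section Borel.
Variables (d : Order.disp_t) (O : orderType d).
Hypothesis wo : well_order (<=%O : rel O).

Lemma wo_least (P : set O) : P !=set0 ->
  exists2 m, P m & forall x, P x -> (m <= x)%O.
Proof.
move=> [x Px]; have [|m [[mP lbm] _]] := wo (A := mem P).
  by exists x; rewrite inE.
by exists m; [rewrite inE in mP|move=> y Py; apply: lbm; rewrite inE].
Qed.

(** Successive least elements enumerate an initial segment. The case of two predecessors supplies an
    index for [Sigma02] strictly below any [a] of index at least 3. *)
Lemma wo_below_card (n : nat) (a : O) :
  `I_n.+1 #<= below a -> exists2 b, (b < a)%O & below b #= `I_n.
Proof.
elim: n a => [|n IH] a leIa.
  have [|m ma mlb] := @wo_least (below a).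
    apply/set0P/eqP => a0; move: leIa; rewrite a0 card_le0 => /eqP I0.
    by have : `I_1 0 by []; rewrite I0.
  exists m => //; rewrite II0 card_eq0; apply/eqP/seteqP; split=> // x xm.
  by have := mlb x (lt_trans xm ma); rewrite leNgt [(x < m)%O]xm.
have [|c ca cn] := IH a.
  by apply: card_le_trans leIa; rewrite card_le_II.
have cSE : below c `|` [set c] #= `I_n.+1.
  apply/eq_cardSP; exists c; first by right.
  rewrite setDUl setDv setU0 setDidl//.
  by apply/seteqP; split=> // x [/= xc xE]; rewrite xE/below/= ltxx in xc.
(* The successor of [c] is the point sought. It exists below [a], since otherwise [below a] would
   have at most [n.+1] elements. *)
have [|m [ma cm] mlb] := @wo_least [set x | (x < a)%O /\ (c < x)%O].
  apply/set0P/eqP => a0; move: leIa.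
  suff /subset_card_le h : below a `<=` below c `|` [set c].
    move=> /card_le_trans/(_ h).
    by rewrite (card_le_eqr cSE) card_le_II ltnn.
  move=> x xa; have [xc|cx|->] := ltgtP x c; [by left| |by right].
  have : [set x | (x < a)%O /\ (c < x)%O] x by split.
  by rewrite a0.
exists m => //; suff -> : below m = below c `|` [set c] by [].
apply/seteqP; split=> x; rewrite /below/=.
  have [xc|cx xm|->] := ltgtP x c; [by left| |by right].
  by have := mlb x (conj (lt_trans xm ma) cx); rewrite leNgt xm.
by case=> [xc|->//]; exact: lt_trans cm.
Qed.

Variables (X : topologicalType) (a : O).
Hypothesis a_ge3 : `I_3 #<= below a.

Lemma Sigma0_at_bigcup (I : countType) (i0 : I) (A : I -> set X) :
  (forall i, exists2 b, (b < a)%O & Sigma0_at b (~` A i)) ->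
  Sigma0_at a (\bigcup_i A i).
Proof.
move=> hA; pose e n := odflt i0 (unpickle n : option I).
(* The default [i0] only repeats a member of the family, so reindexing by [e] leaves the union
   unchanged. *)
have /choice[b hb] : forall n, exists b, (b < a)%O /\ Sigma0_at b (~` A (e n)).
  by move=> n; have [b ? ?] := hA (e n); exists b.
have -> : \bigcup_i A i = \bigcup_n A (e n).
  apply/seteqP; split=> x [i _ Aix]; last by exists (e i).
  by exists (pickle i) => //; rewrite /e pickleK.
by apply: (@Sigma0_at_gt2 _ _ _ _ _ b) => // n; have [] := hb n.
Qed.

Lemma Sigma02_Sigma0_at (A : set X) : Sigma02 A -> Sigma0_at a A.
Proof.
move=> [U [V [oU oV ->]]]; apply: (Sigma0_at_bigcup 0) => n.
have [b ba b2] := wo_below_card a_ge3.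
by exists b => //; apply: Sigma0_at2 b2 _; exact: setC_diff_Sigma02.
Qed.

(** The levels 0, 1 and 2 all lie inside [Sigma02], so a single case covers them. *)
Lemma Sigma0_at_inv (b : O) (A : set X) : Sigma0_at b A ->
  Sigma02 A \/ `I_3 #<= below b /\ exists An : nat -> set X,
    A = \bigcup_n An n /\
    forall n, exists2 c, (c < b)%O & Sigma0_at c (~` An n).
Proof.
case=> [{}b _|{}b U _ oU|{}b S _ S2|{}b An c b3 cb An_c].
- by left; apply: open_Sigma02; exact: open0.
- by left; exact: open_Sigma02.
- by left.
- by right; split=> //; exists An; split=> // n; exists (c n).
Qed.

Lemma Sigma0_atE (A : set X) : Sigma0_at a A -> exists An : nat -> set X,
  A = \bigcup_n An n /\
  forall n, exists2 b, (b < a)%O & Sigma0_at b (~` An n).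
Proof.
move=> /Sigma0_at_inv[[U [V [oU oV ->]]]|[_ //]].
exists (fun n => U n `\` V n); split=> // n.
have [b ba b2] := wo_below_card a_ge3.
by exists b => //; apply: Sigma0_at2 b2 _; exact: setC_diff_Sigma02.
Qed.

Lemma Sigma0_at_setU (A B : set X) :
  Sigma0_at a A -> Sigma0_at a B -> Sigma0_at a (A `|` B).
Proof.
move=> /Sigma0_atE[An [-> hA]] /Sigma0_atE[Bn [-> hB]].
pose C (s : nat + nat) := match s with inl n => An n | inr n => Bn n end.
have -> : \bigcup_n An n `|` \bigcup_n Bn n = \bigcup_s C s.
  apply/seteqP; split=> [x [|] [n _ ?]|x [[n|n] _ ?]].
  - by exists (inl n).
  - by exists (inr n).
  - by left; exists n.
  - by right; exists n.
by apply: (Sigma0_at_bigcup (inl 0)) => -[].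
Qed.

End Borel.

(** Distributing [P] over the union adds the [Sigma02] set [~] P[to each]~[An n]. If [~] An
    n[is]Sigma02[, the result sits at level 2; otherwise its level is at least 3 and
    absorbs]~[P]. *)
Lemma Sigma0_at_setI_Pi02 (d : Order.disp_t) (O : orderType d)
    (X : topologicalType) (a : O) (A P : set X) :
  well_order (<=%O : rel O) -> `I_3 #<= below a ->
  Sigma0_at a A -> Pi02 P -> Sigma0_at a (A `&` P).
Proof.
move=> wo a3 /(Sigma0_atE wo a3)[An [-> hA]] P2; rewrite setI_bigcupl.
apply: (Sigma0_at_bigcup a3 0) => n; rewrite setCI.
have [b ba /[dup] Anb /Sigma0_at_inv[An2|[b3 _]]] := hA n.
  have [c ca c2] := wo_below_card wo a3; exists c => //.
  by apply: Sigma0_at2 c2 _; exact: Sigma02_setU.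
exists b => //; apply: Sigma0_at_setU => //.
exact: Sigma02_Sigma0_at.
Qed.

Lemma Sigma0_at_preimage (d : Order.disp_t) (O : orderType d)
    (X Y : topologicalType) (f : X -> Y) (a : O) (A : set Y) :
  continuous f -> Sigma0_at a A -> Sigma0_at a (f @^-1` A).
Proof.
move=> cf; elim=> {A}a.
- by move=> a0; rewrite preimage_set0; exact: Sigma0_at0.
- move=> U a1 oU; apply: Sigma0_at1 => //.
  by move/continuousP: cf; exact.
- by move=> A a2 A2; apply: Sigma0_at2 => //; exact: Sigma02_preimage.
move=> A b a3 ba _ IH; rewrite preimage_bigcup.
exact: Sigma0_at_gt2 a3 ba IH.
Qed.

(** * Projective classes *)

Lemma preimage_pr (X Y : topologicalType) (f : X -> Y)
    (A : set (baire * Y)%type) :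
  f @^-1` pr_ A = pr_ ((fun z : baire * X => (z.1, f z.2)) @^-1` A).
Proof. by []. Qed.

Lemma continuous_pair_snd (Z X Y : topologicalType) (f : X -> Y) :
  continuous f -> continuous (fun z : Z * X => (z.1, f z.2)).
Proof.
move=> cf z; apply: cvg_pair; first exact: cvg_fst.
by apply: continuous_comp; [exact: cvg_snd|exact: cf].
Qed.

Lemma Sigma1S (n : nat) (X : topologicalType) (A : set X) : 0 < n ->
  Sigma1 n.+1 A =
  exists2 C : set (baire * X)%type, Sigma1 n (~` C) & A = pr_ C.
Proof. by case: n. Qed.

Lemma Sigma1_preimage (n : nat) (X Y : topologicalType) (f : X -> Y)
    (A : set Y) : 0 < n ->
  continuous f -> Sigma1 n A -> Sigma1 n (f @^-1` A).
Proof.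
(* The spaces and the map are generalized because the induction hypothesis is applied to the product
   of [f] with the identity of [baire]. *)
case: n => // n _; elim: n X Y f A => [|n IH] X Y f A cf.
  case=> C C2 ->; rewrite preimage_pr; eexists; last reflexivity.
  by apply: Pi02_preimage C2; exact: continuous_pair_snd.
rewrite !(@Sigma1S n.+1)// => -[C C2 ->]; rewrite preimage_pr.
eexists; last reflexivity.
apply: IH C2; exact: continuous_pair_snd.
Qed.

Lemma pr_setI (X : topologicalType) (A : set (baire * X)%type) (P : set X) :
  pr_ A `&` P = pr_ (A `&` snd @^-1` P).
Proof.
apply/seteqP; split=> [x [[p ?] ?]|x [p [? ?]]]; first by exists p.
by split=> //; exists p.
Qed.

(** The first coordinate of the Baire parameter names the index of a difference containing the
    point. *)
Lemma Sigma02_Sigma1 (X : topologicalType) (A : set X) :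
  Sigma02 A -> Sigma1 1 A.
Proof.
move=> /Sigma02P[U [V [oU oV AE]]].
pose D : set (baire * X)%type := [set z | U (z.1 0) z.2 /\ ~ V (z.1 0) z.2].
exists D; last first.
  apply/seteqP; split=> [x /AE[n ?]|x [p ?]]; last by apply/AE; exists (p 0).
  by exists (fun=> n).
have sndo (W : set X) : open W -> open (snd @^-1` W : set (baire * X)).
  by move: W; apply/continuousP => z; exact: cvg_snd.
have fsto n : open [set z : baire * X | z.1 0 = n].
  have cf : continuous (fun z : baire * X => z.1 0).
    move=> z; apply: (@continuous_comp _ _ _ fst (fun p : baire => p 0)).
      exact: cvg_fst.
    exact: (@proj_continuous nat (fun=> nat) 0).
  by move/continuousP: cf => /(_ [set n]); apply; exact: discrete_open.
(* A pair fails [D] at [n = p 0] either outside [U n] ([true]) or inside [V n] ([false]); fixing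
   [p 0] is an open condition. *)
rewrite /Pi02/=; apply: (@Sigma02_intro _ (nat * bool)%type
  (fun s => [set z : baire * X | z.1 0 = s.1] `&`
            if s.2 then setT else snd @^-1` V s.1)
  (fun s => if s.2 then snd @^-1` U s.1 else set0) (~` D)).
- by move=> [n []]; apply: openI => //=; [exact: openT|exact: sndo].
- by move=> [n []] /=; [exact: sndo|exact: open0].
move=> [p x]; split.
  move=> /not_andP[nU|/contrapT Vx]; first by exists (p 0, true).
  by exists (p 0, false); split=> // -[].
case=> -[n []] /= [[pn +]].
  by rewrite /D/= pn => _ nU [].
by rewrite /D/= pn => Vx _ [].
Qed.

(* Passing from [n] to [n.+1] exchanges the two closure properties, since
   complementation turns an intersection with a [Pi02] set into a union with a
   [Sigma02] set. *)
Lemma Sigma1_closure (n : nat) (X : topologicalType) : 0 < n ->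
  (forall A P : set X, Sigma1 n A -> Pi02 P -> Sigma1 n (A `&` P)) /\
  (forall A S : set X, Sigma1 n A -> Sigma02 S -> Sigma1 n (A `|` S)).
Proof.
have csnd (Z : topologicalType) : continuous (snd : baire * Z -> Z).
  by move=> z; exact: cvg_snd.
case: n => // n _; elim: n X => [|n IH] X.
  split=> [A P [C C2 ->] P2|A S [C C2 ->] /Sigma02_Sigma1[D D2 ->]].
    rewrite pr_setI; eexists; last reflexivity.
    by apply: Pi02_setI => //; exact: (Pi02_preimage (@csnd X)).
  (* Here [S] is itself the projection of the [Pi02] set [D], and projection commutes with
     unions. *)
  exists (C `|` D); first exact: Pi02_setU.
  apply/seteqP; split=> [x [|] [p ?]|x [p []]?].
  - by exists p; left.
  - by exists p; right.
  - by left; exists p.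
  - by right; exists p.
have [IHI IHU] := IH (baire * X)%type.
split=> A P; rewrite !(@Sigma1S n.+1)// => -[C C2 ->] P2.
  rewrite pr_setI; eexists; last reflexivity.
  rewrite setCI; apply: IHU => //.
  exact: (Sigma02_preimage (@csnd X) P2).
exists (C `|` snd @^-1` P).
  rewrite setCU; apply: IHI => //; rewrite /Pi02/= setCK.
  exact: (Sigma02_preimage (@csnd X)).
apply/seteqP; split=> [x [[p ?]|?]|x [p []]?].
- by exists p; left.
- by exists (fun=> 0); right.
- by left; exists p.
- by right.
Qed.

(** * Closure properties common to all the pointclasses *)

Lemma members_preimage (G : pointclass) (X Y : topologicalType) (f : X -> Y)
    (A : set Y) : continuous f -> members G A -> members G (f @^-1` A).
Proof.
move=> cf; case: G => [|a a3|a a3|n n0|n n0] /=.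
- exact: Pi02_preimage.
- exact: Sigma0_at_preimage.
- by exact: Sigma0_at_preimage.
- exact: Sigma1_preimage.
- by exact: Sigma1_preimage.
Qed.

(** For the dual classes [Pi0] and [Pi1], complementation reduces this to unions with a [Sigma02]
    set in [Sigma0] and [Sigma1]. *)
Lemma members_setI_Pi02 (G : pointclass) (X : topologicalType)
    (A P : set X) : members G A -> Pi02 P -> members G (A `&` P).
Proof.
case: G => [|a a3|a a3|n n0|n n0] /=.
- exact: Pi02_setI.
- exact: (Sigma0_at_setI_Pi02 (@co_wo a) a3).
- rewrite /Pi0/= setCI => Aa P2; apply: (Sigma0_at_setU (@co_wo a) a3) => //.
  exact: (Sigma02_Sigma0_at (@co_wo a) a3).
- exact: (Sigma1_closure X n0).1.
- by rewrite /Pi1/= setCI; exact: (Sigma1_closure X n0).2.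
Qed.

(** * Maps that induce the topology of their source *)

(** The source carries the initial topology for [e]; an injective such map is a topological
    embedding. *)
Definition inducing (X Y : topologicalType) (e : X -> Y) : Prop :=
  continuous e /\
  forall U : set X, open U -> exists2 W : set Y, open W & U = e @^-1` W.

Lemma inducing_comp (X Y Z : topologicalType) (e : X -> Y) (g : Y -> Z) :
  inducing e -> inducing g -> inducing (g \o e).
Proof.
move=> [ce oe] [cg og]; split.
  by move=> x; apply: continuous_comp; [exact: ce|exact: cg].
by move=> U /oe[V /og[W oW ->] ->]; exists W.
Qed.

Lemma inducing_set_val (X : topologicalType) (A : set X) :
  inducing (set_val : A -> X).
Proof.
split; first exact: initial_continuous.
by move=> U [W oW <-]; exists W.
Qed.

Lemma inducing_homeomorphism (X Y : topologicalType) (f : X -> Y) :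
  homeomorphism f -> inducing f.
Proof.
move=> [cf [g [cg fK gK]]]; split=> // U oU.
exists (g @^-1` U); first by move/continuousP: cg; exact.
by apply/seteqP; split=> x /=; rewrite fK.
Qed.

Lemma inducing_continuous (X Y Z : topologicalType) (e : Y -> Z) (f : X -> Y) :
  inducing e -> continuous (e \o f) -> continuous f.
Proof.
move=> [_ oe] /continuousP cef; apply/continuousP => U /oe[W oW ->].
exact: cef.
Qed.

(** * The Scott topology and continuous maps into [Pomega] *)

Lemma Pomega_base_open (F : set nat) : finite_set F -> open (Pomega_base F).
Proof.
move=> fF; exists [set F]; first by move=> _ ->.
by rewrite bigcup_set1.
Qed.

Lemma Pomega_openP (W : set Pomega) (S : Pomega) : open W -> W S ->
  exists F, [/\ finite_set F, Pomega_base F S & Pomega_base F `<=` W].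
Proof.
move=> [D DF <-] [F DFF FS]; exists F; split=> //; first exact: DF.
by move=> T FT; exists F.
Qed.

Lemma open_Pomega_mem (n : nat) : open [set S : Pomega | S n].
Proof.
have -> : [set S : Pomega | S n] = Pomega_base [set n].
  by apply/seteqP; split=> S /=; [move=> Sn _ ->|apply].
by apply: Pomega_base_open; exact: finite_set1.
Qed.

(** A basic open set is a finite intersection of the sets given by membership of one number. *)
Lemma continuous_Pomega (X : topologicalType) (f : X -> Pomega) :
  (forall n, open [set x | f x n]) -> continuous f.
Proof.
move=> of_; apply/continuousP => _ [D DF <-].
rewrite preimage_bigcup; apply: bigcup_open => F /DF fF.
rewrite openE => x Fx; case/finite_fsetP: fF => K FK; rewrite FK in Fx *.
apply: (@filter_bigI _ _ K (fun n => [set x | f x n])) => n nK.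
by apply: open_nbhs_nbhs; split=> //; exact: Fx.
Qed.

(* [Pomega] is an injective object for topological embeddings. *)
Lemma Pomega_extension (Z : topologicalType) (e h : Z -> Pomega) :
  inducing e -> continuous h ->
  exists2 F : Pomega -> Pomega, continuous F & forall z, F (e z) = h z.
Proof.
move=> [_ oe] ch.
(* [F S] collects the numbers already forced into [h z] by some finite part [E] of [S]. *)
pose F (S : Pomega) : Pomega := [set n | exists E, [/\ finite_set E,
  Pomega_base E S & forall z, Pomega_base E (e z) -> h z n]].
exists F.
  apply: continuous_Pomega => n.
  have -> : [set S | F S n] = \bigcup_(E in [set E | finite_set E /\
      forall z, Pomega_base E (e z) -> h z n]) Pomega_base E.
    apply/seteqP; split=> [S [E [? ? ?]]|S [E [? ?] ?]]; by exists E.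
  by apply: bigcup_open => E [fE _]; exact: Pomega_base_open.
move=> z; apply/seteqP; split=> n; first by move=> [E [_ Ez]]; exact.
move=> hzn.
have [W oW WE] : exists2 W, open W & [set y | h y n] = e @^-1` W.
  apply: oe; move/continuousP: ch => /(_ [set S | S n]); apply.
  exact: open_Pomega_mem.
(* A basic neighbourhood of [e z] inside [W] is a finite part of [e z] that forces [n]. *)
have [|E [fE Ez EW]] := @Pomega_openP W (e z) oW.
  by rewrite -[W _]/((e @^-1` W) z) -WE.
exists E; split=> // y /EW Wy.
by have : (e @^-1` W) y by []; rewrite -WE.
Qed.

(** Two values differ when some number lies in exactly one of them, which is a countable union of
    differences of open sets; the boolean tells which value contains it. *)
Lemma Pi02_Pomega_eq (X : topologicalType) (f g : X -> Pomega) :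
  continuous f -> continuous g -> Pi02 [set x | f x = g x].
Proof.
have memo (h : X -> Pomega) n : continuous h -> open [set x | h x n].
  move=> /continuousP/(_ [set S | S n]); apply.
  exact: open_Pomega_mem.
move=> cf cg; rewrite /Pi02/=; apply: (@Sigma02_intro _ (nat * bool)%type
  (fun s => [set x | (if s.2 then f x else g x) s.1])
  (fun s => [set x | (if s.2 then g x else f x) s.1])).
- by move=> [n []]; exact: memo.
- by move=> [n []]; exact: memo.
move=> x; split=> [fg|[[n []] /= [? ngx]] /= fgx]; last 2 first.
- by apply: ngx; rewrite -fgx.
- by apply: ngx; rewrite fgx.
apply: contrapT => H; apply: fg; apply/seteqP; split=> n xn;
  apply: contrapT => nxn; apply: H.
- by exists (n, true).
- by exists (n, false).
Qed.

(** * Lavrentiev's construction *)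

Lemma Gamma_space_embedding (G : pointclass) (X : topologicalType) :
  Gamma_space G X -> exists i : X -> Pomega,
    [/\ inducing i, injective i & members G (range i)].
Proof.
move=> [A [GA [f hf]]]; exists (set_val \o f); split.
- apply: inducing_comp; first exact: inducing_homeomorphism.
  exact: inducing_set_val.
- case: hf => _ [g [_ fK _]]; apply: inj_comp; last exact: can_inj fK.
  exact: val_inj.
- suff -> : range (set_val \o f) = A by [].
  case: hf => _ [g [_ _ gK]]; apply/seteqP; split=> [_ [x _ <-]|S AS].
    exact: set_valP.
  by exists (g (SigSub (mem_set AS))) => //=; rewrite gK.
Qed.

Section Lavrentiev.
Variables (X Y : topologicalType) (i : X -> Pomega) (j : Y -> Pomega).
Variables (F G : Pomega -> Pomega).

Definition lavrentiev_dom : set X :=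
  [set x | range j (F (i x)) /\ G (F (i x)) = i x].

Lemma members_lavrentiev_dom (C : pointclass) :
  continuous i -> continuous F -> continuous G ->
  members C (range j) -> members C lavrentiev_dom.
Proof.
move=> ci cF cG Cj.
have cFi : continuous (F \o i).
  by move=> x; apply: continuous_comp; [exact: ci|exact: cF].
apply: (@members_setI_Pi02 C X ((F \o i) @^-1` range j)
                               [set x | G (F (i x)) = i x]).
  exact: members_preimage.
apply: Pi02_Pomega_eq => //.
by move=> x; apply: (continuous_comp (cFi x)); exact: cG.
Qed.

End Lavrentiev.

Lemma lavrentiev_map (X Y : topologicalType) (i : X -> Pomega)
    (j : Y -> Pomega) (F G : Pomega -> Pomega) :
  inducing i -> inducing j -> continuous F ->
  exists2 h : lavrentiev_dom i j F G -> lavrentiev_dom j i G F,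
    continuous h & forall x, j (set_val (h x)) = F (i (set_val x)).
Proof.
move=> [ci _] ij cF.
have /choice[h hE] : forall x : lavrentiev_dom i j F G,
    exists y : lavrentiev_dom j i G F, j (set_val y) = F (i (set_val x)).
  move=> x; have [[y _ yE] GF] : lavrentiev_dom i j F G (set_val x).
    exact: set_valP.
  (* From [j y = F (i x)] and [G (F (i x)) = i x] follow [G (j y) = i x] and [F (G (j y)) = j y]. *)
  have yD : lavrentiev_dom j i G F y.
    by rewrite /lavrentiev_dom/= yE GF; split=> //; exists (set_val x).
  by exists (SigSub (mem_set yD)).
exists h => //.
apply: (inducing_continuous (inducing_comp (@inducing_set_val _ _) ij)).
have -> : (j \o set_val) \o h = F \o (i \o set_val) by apply/funext.
have [cv _] := @inducing_set_val X (lavrentiev_dom i j F G).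
move=> x; apply: continuous_comp; last exact: cF.
by apply: continuous_comp; [exact: cv|exact: ci].
Qed.

Theorem theorem3p6 :
  forall (G : pointclass) (X Y : topologicalType),
  Gamma_space G X -> Gamma_space G Y ->
  forall (A : set X) (B : set Y) (f : A -> B), homeomorphism f ->
  exists (As : set X) (Bs : set Y) (fs : As -> Bs),
    [/\ members G As, members G Bs, homeomorphism fs,
        A `<=` As /\ B `<=` Bs &
        forall (x : A) (x' : As), set_val x = set_val x' ->
          set_val (fs x') = set_val (f x)].
Proof.
move=> C X Y /Gamma_space_embedding[i [ii inji Ci]].
move=> /Gamma_space_embedding[j [ij injj Cj]] A B f [cf [g [cg fK gK]]].
have iA := inducing_comp (@inducing_set_val X A) ii.
have jB := inducing_comp (@inducing_set_val Y B) ij.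
(* [F] extends [f] read through the embeddings, and [G] below extends its inverse [g]. *)
have [|F cF FE] := @Pomega_extension A (i \o set_val) ((j \o set_val) \o f) iA.
  by move=> x; apply: continuous_comp; [exact: cf|exact: jB.1].
have [|G cG GE] := @Pomega_extension B (j \o set_val) ((i \o set_val) \o g) jB.
  by move=> x; apply: continuous_comp; [exact: cg|exact: iA.1].
have [h ch hE] := @lavrentiev_map X Y i j F G ii ij cF.
have [k ck kE] := @lavrentiev_map Y X j i G F ij ii cG.
exists (lavrentiev_dom i j F G), (lavrentiev_dom j i G F), h; split.
- by apply: members_lavrentiev_dom => //; exact: ii.1.
- by apply: members_lavrentiev_dom => //; exact: ij.1.
(* After applying the injections [i] and [j], the two cancellation laws are the fixed-point
   equations defining the domains. *)
- split=> //; exists k; split=> // z; apply: val_inj.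
  + apply: inji; rewrite -set_valE kE hE.
    by have [] : lavrentiev_dom i j F G (set_val z) by exact: set_valP.
  + apply: injj; rewrite -set_valE hE kE.
    by have [] : lavrentiev_dom j i G F (set_val z) by exact: set_valP.
(* On [A] the composite of [F] and [G] acts as [g] after [f], hence as the identity; symmetrically
   on [B]. *)
- split=> [x Ax|y By].
    pose a : A := SigSub (mem_set Ax).
    have Fx : F (i x) = j (set_val (f a)) by exact: FE a.
    split; rewrite Fx; first by exists (set_val (f a)).
    by have /= -> := GE (f a); rewrite fK.
  pose b : B := SigSub (mem_set By).
  have Gy : G (j y) = i (set_val (g b)) by exact: GE b.
  split; rewrite Gy; first by exists (set_val (g b)).
  by have /= -> := FE (g b); rewrite gK.
- move=> x x' xx'; apply: injj; rewrite hE -xx'.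
  exact: FE x.
Qed.
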